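(* Let $\Omega\subset\mathbb{R}^{2}$ be a domain, $\vec F\in C^{1}(\Omega)$ a planar vector field, $H\in C^{0}(\Omega)$, and let $u:\Omega\to\mathbb{R}$ be a $C^{1}$ smooth function with $\nabla u+\vec F\neq0$ everywhere in $\Omega$ such that, with $N\equiv\frac{\nabla u+\vec F}{|\nabla u+\vec F|}$, $$\int_{\Omega}N\cdot\nabla\varphi+\int_{\Omega}H\varphi=0\qquad\text{for all }\varphi\in C_{0}^{\infty}(\Omega).$$ Let $p_{0}\in\Omega$, and let $s,t$ be characteristic coordinates near $p_{0}$ with associated positive continuous functions $f,g$ (as described in the context). Let $\theta$ be a continuous function near $p_{0}$ with $N=(\cos\theta,\sin\theta)$. Then, in the coordinates $(s,t)$, $\theta$ is $C^{1}$ smooth in $s$ (i.e. $\partial\theta/\partial s$ exists and is continuous) and $$\theta_{s}\equiv\frac{\partial\theta}{\partial s}=-\frac{H}{f}.$$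
   Context: $N^{\perp}$ is the rotation of $N$ by $-\pi/2$, i.e. $N^{\perp}=(\sin\theta,-\cos\theta)$. Put $D\equiv|\nabla u+\vec F|$ and, for $\vec F=(F_1,F_2)$, $\operatorname{rot}\vec F:=(F_{2})_{x}-(F_{1})_{y}$. Seed curves are integral curves of $N$; characteristic curves are integral curves of $N^{\perp}$. For a continuous function $f$, $Nf$ (resp. $N^{\perp}f$) denotes the arc-length derivative of $f$ along seed curves in direction $N$ (resp. along characteristic curves in direction $N^{\perp}$). Characteristic coordinates near $p_{0}$: in the setting of the claim there exist, on a neighborhood of $p_{0}$, real $C^{1}$ functions $s,t$ and positive continuous functions $f,g$ such that $\{t=\text{constant}\}$ are characteristic curves, $\{s=\text{constant}\}$ are seed curves, $\nabla s=fN^{\perp}$, $\nabla t=gDN$, $Nf$ and $N^{\perp}g$ exist and are continuous with $Nf+fH=0$ and $N^{\perp}g+\frac{(\operatorname{rot}\vec F)g}{D}=0$, and $\Psi:(x,y)\mapsto(s,t)$ is a $C^{1}$ diffeomorphism onto its image with $\Psi^{*}\big(\frac{ds^{2}}{f^{2}}+\frac{dt^{2}}{g^{2}D^{2}}\big)=dx^{2}+dy^{2}$. *)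

(* Defs.v *)
From HB Require Import structures.
From mathcomp Require Import all_boot all_order all_algebra.
From mathcomp Require Import all_classical all_reals all_analysis.

Set Implicit Arguments.
Unset Strict Implicit.
Unset Printing Implicit Defensive.

Import Order.TTheory GRing.Theory Num.Theory.
Import numFieldNormedType.Exports.

Local Open Scope classical_set_scope.
Local Open Scope ring_scope.

Section PlaneCalculus.
Context {R : realType}.
Implicit Types (U : set (R * R)) (h : R * R -> R) (V : R * R -> R * R).

Definition dx h (p : R * R) : R := 'D_((1, 0) : R * R) h p.
Definition dy h (p : R * R) : R := 'D_((0, 1) : R * R) h p.
Definition grad h (p : R * R) : R * R := (dx h p, dy h p).

Definition dot (v w : R * R) : R := v.1 * w.1 + v.2 * w.2.

(* The norm that the library puts on R * R is the max norm, so the Euclidean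
   norm is spelled out; both induce the same topology. *)
Definition enorm (v : R * R) : R := Num.sqrt (dot v v).

Definition rot V (p : R * R) : R :=
  dx (fun q => (V q).2) p - dy (fun q => (V q).1) p.

Definition cont_on U h := forall p, U p -> {for p, continuous h}.

(* h is of class C^k on the open set U; values of h outside U are irrelevant. *)
Fixpoint Ck_on (k : nat) U h : Prop :=
  if k is k'.+1 then
    [/\ forall p, U p -> differentiable h p, Ck_on k' U (dx h)
      & Ck_on k' U (dy h)]
  else cont_on U h.

Definition Ck_map_on (k : nat) U V : Prop :=
  Ck_on k U (fun p => (V p).1) /\ Ck_on k U (fun p => (V p).2).

(* Elements of C_0^oo(Omega), extended by 0 to the whole plane. *)
Definition test_function U h : Prop :=
  [/\ forall k, Ck_on k setT h,
      compact (closure [set p | h p != 0])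
    & closure [set p | h p != 0] `<=` U].

Definition domain U : Prop := [/\ open U, connected U & U !=set0].

(* psi is a C^1 diffeomorphism of the open set U onto its (open) image; phi
   agrees with the inverse there, and its values elsewhere are irrelevant. *)
Definition C1_diffeo U (psi phi : R * R -> R * R) : Prop :=
  [/\ open U, open (psi @` U), Ck_map_on 1 U psi, Ck_map_on 1 (psi @` U) phi
    & forall p, U p -> phi (psi p) = p].

Definition integral_curve V U (a b : R) (gamma : R -> R * R) : Prop :=
  forall r, a < r < b ->
    U (gamma r) /\ is_derive r (1 : R) gamma (V (gamma r)).

(* For a unit field V, dh is the arc-length derivative of h along the integral
   curves of V contained in U.  Integral curves of a field that is merely
   continuous need not be unique, so all of them are considered. *)
Definition derivative_along V U h dh : Prop :=
  forall (a b : R) (gamma : R -> R * R), integral_curve V U a b gamma ->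
    forall r, a < r < b -> is_derive r (1 : R) (h \o gamma) (dh (gamma r)).

(* The level sets {h = constant} in U are, locally, traces of integral curves
   of V. *)
Definition level_curves V U h : Prop :=
  forall p, U p -> exists (O : set (R * R)) (a b : R) (gamma : R -> R * R),
    [/\ open O, O p, O `<=` U, integral_curve V O a b gamma
      & gamma @` `]a, b[ = O `&` [set q | h q = h p]].

End PlaneCalculus.

Section PMeanCurvature.
Context {R : realType}.
Variables (u : R * R -> R) (F : R * R -> R * R).

Definition Dfun (p : R * R) : R := enorm (grad u p + F p).

Definition Nfun (p : R * R) : R * R := (Dfun p)^-1 *: (grad u p + F p).

(* Rotation of N by -pi/2: (cos theta, sin theta) |-> (sin theta, -cos theta). *)
Definition Nperp (p : R * R) : R * R := ((Nfun p).2, - (Nfun p).1).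

Definition lebesgue2 : set (measurableTypeR R * measurableTypeR R) -> \bar R :=
  (@lebesgue_measure R \x @lebesgue_measure R)%E.

Definition weak_solution (H : R * R -> R) (Omega : set (R * R)) : Prop :=
  forall phi : R * R -> R, test_function Omega phi ->
    (\int[lebesgue2]_(p in Omega) (dot (Nfun p) (grad phi p))%:E
     + \int[lebesgue2]_(p in Omega) (H p * phi p)%:E = 0)%E.

(* psi = (s, t) : U -> R^2 is the coordinate map and psi_inv its inverse. *)
Record characteristic_coordinates (H : R * R -> R) (U : set (R * R))
    (s t f g : R * R -> R) (psi_inv : R * R -> R * R) : Prop := {
  cc_s_C1 : Ck_on 1 U s;
  cc_t_C1 : Ck_on 1 U t;
  cc_f_cont : cont_on U f;
  cc_g_cont : cont_on U g;
  cc_f_gt0 : forall p, U p -> 0 < f p;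
  cc_g_gt0 : forall p, U p -> 0 < g p;
  cc_t_level : level_curves Nperp U t;
  cc_s_level : level_curves Nfun U s;
  cc_grad_s : forall p, U p -> grad s p = f p *: Nperp p;
  cc_grad_t : forall p, U p -> grad t p = (g p * Dfun p) *: Nfun p;
  cc_Nf : exists Nf : R * R -> R,
    [/\ derivative_along Nfun U f Nf, cont_on U Nf
      & forall p, U p -> Nf p + f p * H p = 0];
  cc_Nperp_g : exists Npg : R * R -> R,
    [/\ derivative_along Nperp U g Npg, cont_on U Npg
      & forall p, U p -> Npg p + rot F p * g p / Dfun p = 0];
  cc_diffeo : C1_diffeo U (fun p => (s p, t p)) psi_inv;
  (* the pullback of ds^2/f^2 + dt^2/(g^2 D^2), as a quadratic form at p *)
  cc_metric : forall p, U p -> forall v : R * R,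
    ('D_v s p) ^+ 2 / (f p) ^+ 2 + ('D_v t p) ^+ 2 / ((g p) ^+ 2 * (Dfun p) ^+ 2)
    = v.1 ^+ 2 + v.2 ^+ 2
}.

End PMeanCurvature.

(* Main.v *)
(** The field N calibrates the characteristic curves: along a characteristic
    curve gamma, parametrized by arc length, the form N^perp . dz = ds / f
    measures the length of gamma, and on any other curve it is at most the
    length.  Compare gamma with its translate by a small vector x V, where
    V = N (p) for a point p = gamma (r0).  Let Phi_x (r) be the arc-length
    parameter, minus r, of the point of gamma that has the same coordinate s as
    z = gamma (r) + x V, and let w be that point.  Then
      Phi_x' (r) = (f z / f w) (N^perp z . N^perp (gamma r)) - 1 <= f z / f w - 1,
    and since z and w lie on one seed curve, where Nf = - f H, the right-hand
    side is - x H (p) + o (x) near p.  Letting x tend to 0 from both sides turns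
    this inequality into an equality for the x-derivative of Phi_x (r) at 0,
    which is N^perp (gamma r) . V = sin (theta (gamma r) - theta (p)); hence
    theta \o gamma has derivative - H (p) at r0. *)
Require Import Defs.
From mathcomp Require Import all_boot all_order all_algebra.
From mathcomp Require Import all_classical all_reals all_analysis.
From mathcomp Require Import ring lra.
Import Order.TTheory GRing.Theory Num.Theory.
Import numFieldNormedType.Exports.
Local Open Scope classical_set_scope.
Local Open Scope ring_scope.
Set Implicit Arguments.
Unset Strict Implicit.
Unset Printing Implicit Defensive.

(** * Chain rules, inverse functions and mean values in one variable *)

Lemma dotZl (R : realType) (k : R) (v w : R * R) : dot (k *: v) w = k * dot v w.
Proof. by rewrite /dot /= -!mulrA -mulrDr. Qed.

Lemma derive_dot_grad (R : realType) (h : R * R -> R) (p v : R * R) :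
  differentiable h p -> 'D_v h p = dot (grad h p) v.
Proof.
move=> dh; rewrite /grad /dx /dy /dot !deriveE//=.
have -> : v = v.1 *: ((1, 0) : R * R) + v.2 *: ((0, 1) : R * R).
  by case: v => v1 v2 /=; congr (_, _); rewrite /= !scaler0 ?addr0 ?add0r [_ *: _]mulr1.
rewrite linearD !linearZ /= !scaler0 ?addr0 ?add0r [_%:A]mulr1 [_%:A]mulr1.
by rewrite mulrC [X in _ + X = _]mulrC.
Qed.

Lemma is_derive_along_curve (R : realType) (h : R * R -> R) (gamma : R -> R * R) (r : R)
    (v : R * R) :
  differentiable h (gamma r) -> is_derive r 1 gamma v ->
  is_derive r 1 (h \o gamma) (dot (grad h (gamma r)) v).
Proof.
move=> dh [/derivable1_diffP dg dgv].
have dhg : differentiable (h \o gamma) r by exact: differentiable_comp.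
apply: DeriveDef; first exact: diff_derivable.
by rewrite deriveE// diff_comp//= -derive_dot_grad// (deriveE _ dh) -dgv deriveE.
Qed.

Lemma is_derive_comp1 (R : realType) (h k : R -> R) (r dh dk : R) :
  is_derive (k r) 1 h dh -> is_derive r 1 k dk -> is_derive r 1 (h \o k) (dh * dk).
Proof.
move=> [hd <-] [kd <-].
apply: DeriveDef.
  by apply/derivable1_diffP/differentiable_comp; apply/derivable1_diffP.
by rewrite -!derive1E derive1_comp.
Qed.

Lemma increasing_left_inverse (R : realType) (k dk : R -> R) (a b : R) :
  (forall r, a < r < b -> is_derive r 1 k (dk r)) ->
  (forall r, a < r < b -> 0 < dk r) ->
  exists A : R -> R, forall r, a < r < b ->
    A (k r) = r /\ is_derive (k r) 1 A (dk r)^-1.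
Proof.
move=> kd dk0.
have kmono : {in `]a, b[%R &, {homo k : x y / x < y}}.
  apply: gtr0_derive1_lt_oo => x; rewrite ?inE/= ?in_itv/= => xab.
  - by have [] := kd _ xab.
  - by rewrite derive1E; have [_ ->] := kd _ xab; exact: dk0.
  - by apply/differentiable_continuous/derivable1_diffP; have [] := kd _ xab.
have kinj x y : a < x < b -> a < y < b -> k x = k y -> x = y.
  move=> xab yab kxy; case: (ltgtP x y) => // /kmono;
    by rewrite !in_itv/= kxy ltxx xab yab => /(_ isT isT).
(* Outside the image of the interval [A] takes the default value 0; the claims concern only the
   points [k r], which are interior to that image. *)
pose A x := xget 0 [set r | a < r < b /\ k r = x].
have Ak r : a < r < b -> A (k r) = r.
  move=> rab; rewrite /A; case: xgetP => [x _ [xab]|/(_ r)/=]; last by case.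
  exact: kinj.
exists A => r rab; split; first exact: Ak.
have nr : \forall z \near r, a < z < b by exact: near_in_itvoo.
apply: (@is_derive_inverse R k).
- by apply: filterS nr => z /Ak.
- apply: filterS nr => z /kd[/derivable1_diffP ? _].
  exact: differentiable_continuous.
- exact: kd.
- by rewrite gt_eqF ?dk0.
Qed.
(** Dividing the bound by x > 0 keeps the inequality and dividing by x < 0 reverses it, so a bound
    from above alone confines the derivative from both sides. This is what turns the calibration
    inequality into an equality. *)
Lemma one_sided_slope (R : realType) (psi : R -> R) (m c e : R) :
  is_derive (0 : R) 1 psi m -> psi 0 = 0 ->
  (\forall x \near (0 : R), psi x <= x * c + `|x| * e) -> `|m - c| <= e.
Proof.
move=> [psid <-] psi0 hle.
have lim0 : (fun x => x^-1 * psi x) @ (0 : R)^' --> 'D_1 psi 0.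
  have -> : (fun x => x^-1 * psi x)
            = (fun h => h^-1 *: ((psi \o shift (0 : R)) (h *: 1) - psi 0)).
    by apply/funext => h /=; rewrite psi0 subr0 addr0 [h *: 1]mulr1.
  exact: psid.
have limr := cvg_dnbhs_at_right lim0; have liml := cvg_dnbhs_at_left lim0.
rewrite ler_distl; apply/andP; split.
- rewrite -(cvg_lim _ liml)//; apply: limr_ge; first by apply/cvg_ex; eexists; exact: liml.
  near=> x; have x0 : x < 0 by [].
  have : psi x <= x * c + `|x| * e.
    by near: x; exact: cvg_within.
  rewrite ltr0_norm// mulNr -mulrBr => h.
  by rewrite ler_ndivlMl.
- rewrite -(cvg_lim _ limr)//; apply: limr_le; first by apply/cvg_ex; eexists; exact: limr.
  near=> x; have x0 : 0 < x by [].
  have : psi x <= x * c + `|x| * e.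
    by near: x; exact: cvg_within.
  by rewrite gtr0_norm// -mulrDr => h; rewrite ler_pdivrMl.
Unshelve. all: by end_near. Qed.

(** The intermediate point is located only in the ball, so that [a] and [b] may come in either
    order; increments of both signs occur below. *)
Lemma MVT_ball (R : realType) (h dh : R -> R) (c e a b : R) :
  (forall x, ball c e x -> is_derive x 1 h (dh x)) -> ball c e a -> ball c e b ->
  exists2 x, ball c e x & h b - h a = dh x * (b - a).
Proof.
move=> hd; wlog : a b / a <= b => [wl ca cb|ab ca cb].
  have [/wl|/ltW/wl] := leP a b; first exact.
  move=> /(_ cb ca)[x cx E]; exists x => //.
  by rewrite -opprB E -mulrN opprB.
have sub x : a <= x <= b -> ball c e x.
  move=> xab; move: ca cb; rewrite -!ball_normE/= !ltr_distlC => ca cb.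
  lra.
have [||x xab E] := @MVT_segment _ h dh a b ab.
- by move=> x; rewrite in_itv/= => /andP[ax xb]; apply/hd/sub; rewrite !ltW.
- apply: derivable_within_continuous => x; rewrite in_itv/= => /sub/hd; by case.
- by exists x => //; apply: sub; move: xab; rewrite in_itv.
Qed.

(** * Level curves parametrized by a coordinate *)

Section LevelCurves.
Context {R : realType} (U : set (R * R)) (c lam h dh e : R * R -> R)
  (X : R * R -> R * R) (P : R -> R * R) (x0 : R).
Hypothesis c_diff : forall p, U p -> differentiable c p.
Hypothesis c_grad : forall p, U p -> grad c p = lam p *: X p.
Hypothesis X_unit : forall p, U p -> dot (X p) (X p) = 1.
Hypothesis lam_gt0 : forall p, U p -> 0 < lam p.
Hypothesis e_level : level_curves X U e.
Hypothesis P_cont : P x @[x --> x0] --> P x0.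
Hypothesis UP : U (P x0).
Hypothesis P_coord : \forall x \near x0, c (P x) = x /\ e (P x) = e (P x0).

(** Along a unit-speed curve of [X] the coordinate [c] grows at rate [lam] > 0, so it can be
    inverted: [A] is arc length as a function of [c]. Near [x0] the point [P x] stays in the open
    set where the level set of [e] is the trace of [gamma], and [A] recovers its parameter. The pair
    ([c], [e]) will be (t, s) on seed curves and (s, t) on characteristic curves. *)
Lemma level_curve_coordinate :
  exists (a b : R) (gamma : R -> R * R) (A : R -> R),
    [/\ integral_curve X U a b gamma,
        forall r, a < r < b -> e (gamma r) = e (P x0) /\ A (c (gamma r)) = r
      & \forall x \near x0, [/\ a < A x < b, gamma (A x) = P x
                              & is_derive x 1 A (lam (P x))^-1]].
Proof.
have [B [a [b [gamma [oB BP BU gB img]]]]] := e_level UP.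
have gU r : a < r < b -> U (gamma r) by move=> /gB[/BU].
have [A AP] : exists A : R -> R, forall r, a < r < b ->
    A ((c \o gamma) r) = r /\ is_derive ((c \o gamma) r) 1 A (lam (gamma r))^-1.
  apply: increasing_left_inverse => r rab; last exact/lam_gt0/gU.
  have [_ gd] := gB _ rab.
  have := is_derive_along_curve (c_diff (gU _ rab)) gd.
  by rewrite c_grad ?dotZl ?X_unit ?mulr1 //; exact: gU.
exists a, b, gamma, A; split.
- by move=> r rab; split; [exact: gU | have [] := gB _ rab].
- move=> r rab; split; last by have [] := AP _ rab.
  have : (gamma @` `]a, b[) (gamma r).
    by exists r => //=; rewrite in_itv.
  by rewrite img => -[].
- have PB : \forall x \near x0, B (P x) by apply: P_cont; exact: open_nbhs_nbhs.
  near=> x; have BPx : B (P x) by near: x.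
  have [cPx ePx] : c (P x) = x /\ e (P x) = e (P x0) by near: x.
  have : (gamma @` `]a, b[) (P x) by rewrite img; split.
  move=> [r/= ]; rewrite in_itv/= => rab grP.
  have := AP _ rab; rewrite /= grP cPx => -[-> ?]; split => //.
Unshelve. all: by end_near. Qed.

(** Only the derivative of [h] along the curves is given, so [P] is rewritten as [gamma \o A] before
    the chain rule is used. *)
Lemma is_derive_coordinate : derivative_along X U h dh ->
  is_derive x0 1 (h \o P) (dh (P x0) / lam (P x0)).
Proof.
move=> hd; have [a [b [gamma [A [gU _ nA]]]]] := level_curve_coordinate.
have [Aab gA Ad] := nbhs_singleton nA.
apply: (@near_eq_is_derive _ _ _ ((h \o gamma) \o A)).
  by apply: filterS nA => x [_ /= -> _].
apply: (@is_derive_comp1 _ (h \o gamma) A).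
by rewrite -gA; exact: (hd _ _ _ gU _ Aab).
Qed.

End LevelCurves.

(** * Estimates, translates and angles *)

Lemma dot_unit_le1 (R : realType) (v w : R * R) :
  dot v v = 1 -> dot w w = 1 -> dot v w <= 1.
Proof.
rewrite /dot => v1 w1.
have := sqr_ge0 (v.1 - w.1); have := sqr_ge0 (v.2 - w.2); nra.
Qed.

Lemma is_derive_of_estimate (R : realType) (m : R -> R) (r0 l : R) :
  (forall e, 0 < e -> \forall r \near r0, `|m r - m r0 - l * (r - r0)| <= e * `|r - r0|) ->
  is_derive r0 1 m l.
Proof.
move=> est.
suff ml : (fun h => h^-1 *: ((m \o shift r0) (h *: 1) - m r0)) @ (0 : R)^' --> l.
  by apply: DeriveDef; [apply/cvg_ex; exists l | exact: cvg_lim].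
apply/cvgrPdist_le => e e0.
have /nbhs_ballP[d /= d0 near_r0] := est e e0.
near=> h.
have h0 : h != 0 by near: h; exact: nbhs_dnbhs_neq.
have hd : ball r0 d (h + r0).
  rewrite -ball_normE/= opprD addrCA subrr addr0 normrN.
  by near: h; apply: dnbhs0_lt.
have := near_r0 _ hd; rewrite addrK /= [h *: 1]mulr1.
rewrite -ler_pdivrMr ?normr_gt0// -normfV -normrM; apply: le_trans.
rewrite -normrN le_eqVlt; apply/orP; left; apply/eqP; congr `| _ |.
by rewrite /GRing.scale/=; field.
Unshelve. all: by end_near. Qed.
Lemma is_derive_line (R : realType) (z v : R * R) (x : R) :
  is_derive x (1 : R) (fun x : R => z + x *: v) v.
Proof.
have dv : is_derive x (1 : R) (fun x : R => x *: v) v.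
  apply: DeriveDef.
    by apply/derivable1_diffP; exact: differentiableZl.
  by rewrite deriveE ?diff_val ?scale1r.
rewrite -[X in is_derive _ _ _ X]add0r; exact: is_deriveD.
Qed.

Lemma is_derive_translate (R : realType) (gamma : R -> R * R) (r : R) (w c : R * R) :
  is_derive r (1 : R) gamma w -> is_derive r (1 : R) (fun r => gamma r + c) w.
Proof.
by move=> ?; rewrite -[w]addr0; exact: is_deriveD.
Qed.

Lemma is_derive_row (R : realType) (h : R * R -> R) (q : R * R) (l : R) :
  is_derive q.1 1 (fun x => h (x, q.2)) l -> is_derive q ((1, 0) : R * R) h l.
Proof.
move=> [hd hl].
have E : (fun k : R => k^-1 *: ((h \o shift q) (k *: ((1, 0) : R * R)) - h q)) =
    (fun k : R => k^-1 *: (((fun x => h (x, q.2)) \o shift q.1) (k *: 1) - h (q.1, q.2))).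
  apply/funext => k /=; congr (_ *: (h _ - h _)); last by case: (q).
  by case: (q) => q1 q2; congr (_, _); rewrite /= scaler0 add0r.
by apply: DeriveDef; rewrite ?/derivable ?/derive E.
Qed.

(** By continuity [th r - th r0] stays within pi / 2 of 0 near [r0], where [asin] undoes [sin]; and
    [asin] has slope 1 at 0. *)
Lemma is_derive_angle (R : realType) (th : R -> R) (r0 k : R) :
  {for r0, continuous th} ->
  is_derive r0 1 (fun r => sin (th r - th r0)) k -> is_derive r0 1 th k.
Proof.
move=> thc sd.
have nearE : \forall r \near r0, asin (sin (th r - th r0)) + th r0 = th r.
  have pi20 : 0 < pi / 2 :> R by rewrite divr_gt0 ?pi_gt0.
  have thB : \forall r \near r0, ball (th r0) (pi / 2) (th r).
    by apply: thc; exact: nbhsx_ballx.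
  apply: filterS thB => r; rewrite -ball_normE/= ltr_distlC => /andP[h1 h2].
  by rewrite sinK ?subrK// in_itv/= lerBrDr lerBlDr ![_ + th r0]addrC !ltW.
apply: (near_eq_is_derive nearE).
have ad : is_derive (sin (th r0 - th r0)) 1 (@asin R) 1.
  rewrite subrr sin0.
  have : is_derive (0 : R) 1 (@asin R) (Num.sqrt (1 - 0 ^+ 2))^-1.
    by apply: is_derive1_asin; rewrite ltrN10 ltr01.
  by rewrite expr0n/= subr0 sqrtr1 invr1.
have := @is_derive_comp1 _ (@asin R) (fun r => sin (th r - th r0)) r0 1 k ad sd.
rewrite mul1r => ?; rewrite -[k]addr0; exact: is_deriveD.
Qed.

(** * The turning rate of the unit field along characteristic curves *)

Definition perp {R : realType} (v : R * R) : R * R := (v.2, - v.1).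

Section TurningRate.
Context {R : realType} (U : set (R * R)) (s t f lam H : R * R -> R)
  (V : R * R -> R * R) (psi_inv : R * R -> R * R).
Hypothesis s_diff : forall p, U p -> differentiable s p.
Hypothesis t_diff : forall p, U p -> differentiable t p.
Hypothesis s_grad : forall p, U p -> grad s p = f p *: perp (V p).
Hypothesis t_grad : forall p, U p -> grad t p = lam p *: V p.
Hypothesis V_unit : forall p, U p -> dot (V p) (V p) = 1.
Hypothesis f_gt0 : forall p, U p -> 0 < f p.
Hypothesis lam_gt0 : forall p, U p -> 0 < lam p.
Hypothesis f_cont : cont_on U f.
Hypothesis lam_cont : cont_on U lam.
Hypothesis H_cont : cont_on U H.
Hypothesis V_cont : forall p, U p -> {for p, continuous V}.
Hypothesis t_level : level_curves (perp \o V) U t.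
Hypothesis s_level : level_curves V U s.
Hypothesis f_along : derivative_along V U f (fun p => - (f p * H p)).
Hypothesis diffeo : C1_diffeo U (fun p => (s p, t p)) psi_inv.

Let psi p := (s p, t p).

Lemma U_open : open U. Proof. by have [] := diffeo. Qed.

Lemma psi_invK q : (psi @` U) q -> U (psi_inv q) /\ psi (psi_inv q) = q.
Proof. by have [_ _ _ _ K] := diffeo => -[p Up <-]; rewrite K. Qed.

Lemma psi_inv_cont q : (psi @` U) q -> {for q, continuous psi_inv}.
Proof.
have [_ _ _ [[d1 _ _] [d2 _ _]] _] := diffeo => Eq.
have -> : psi_inv = fun q => ((psi_inv q).1, (psi_inv q).2).
  by apply/funext => q'; case: (psi_inv q').
exact: differentiable_continuous (differentiable_pair (d1 _ Eq) (d2 _ Eq)).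
Qed.

Lemma psi_cont p : U p -> {for p, continuous psi}.
Proof.
move=> Up; exact: differentiable_continuous
  (differentiable_pair (s_diff Up) (t_diff Up)).
Qed.

Lemma psiU_open : open (psi @` U). Proof. by have [] := diffeo. Qed.

Lemma row_cont (q : R * R) : (x, q.2) @[x --> q.1] --> q.
Proof. case: q => x y; exact: (differentiable_continuous (differentiable_pair _ _)). Qed.

Lemma col_cont (q : R * R) : (q.1, y) @[y --> q.2] --> q.
Proof. case: q => x y; exact: (differentiable_continuous (differentiable_pair _ _)). Qed.

Lemma perp_unit p : U p -> dot (perp (V p)) (perp (V p)) = 1.
Proof. by move=> /V_unit; rewrite /dot /= mulrNN addrC. Qed.

(** A vertical line of the (s, t)-plane is a seed curve, on which t has speed [lam]; the arc-length
    derivative - f H is therefore divided by [lam]. *)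
Lemma is_derive_f_col q : (psi @` U) q ->
  is_derive q.2 1 (fun y => f (psi_inv (q.1, y)))
    (- (f (psi_inv q) * H (psi_inv q)) / lam (psi_inv q)).
Proof.
move=> Eq; have [UP PK] := psi_invK Eq.
have qE : q = (q.1, q.2) by case: (q).
have s0 : s (psi_inv q) = q.1 by rewrite -[in RHS]PK.
have := @is_derive_coordinate R U t lam f (fun p => - (f p * H p)) s V
  (fun y => psi_inv (q.1, y)) q.2 t_diff t_grad V_unit lam_gt0 s_level.
rewrite /= -qE s0; apply => //.
- by apply: cvg_comp; [exact: col_cont | exact: psi_inv_cont].
- have : \forall y \near q.2, (psi @` U) (q.1, y).
    by apply: col_cont; apply: open_nbhs_nbhs; split => //; exact: psiU_open.
  by apply: filterS => y /psi_invK[_ [-> ->]].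
Qed.

(** The same construction with s and t exchanged. The curve and its arc length [A] are kept, because
    the curve is going to be translated. *)
Lemma row_curve q : (psi @` U) q ->
  exists (a b : R) (gamma : R -> R * R) (A : R -> R),
    [/\ integral_curve (perp \o V) U a b gamma,
        forall r, a < r < b -> t (gamma r) = q.2 /\ A (s (gamma r)) = r
      & \forall x \near q.1, [/\ a < A x < b, gamma (A x) = psi_inv (x, q.2)
                              & is_derive x 1 A (f (psi_inv (x, q.2)))^-1]].
Proof.
move=> Eq; have [UP PK] := psi_invK Eq.
have qE : q = (q.1, q.2) by case: (q).
have t0 : t (psi_inv q) = q.2 by rewrite -[in RHS]PK.
have := @level_curve_coordinate R U s f t (perp \o V)
  (fun x => psi_inv (x, q.2)) q.1 s_diff s_grad perp_unit f_gt0 t_level.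
rewrite /= -qE t0; apply => //.
- by apply: cvg_comp; [exact: row_cont | exact: psi_inv_cont].
- have : \forall x \near q.1, (psi @` U) (x, q.2).
    by apply: row_cont; apply: open_nbhs_nbhs; split => //; exact: psiU_open.
  by apply: filterS => y /psi_invK[_ [-> ->]].
Qed.

(** Both z and w = [psi_inv (s z, t p)] have the same s, so f z - f w is controlled by t z - t p,
    which is of order x because [t z0 = t p]. The radius [d] is uniform in [z0] and [x], so one
    bound serves a whole arc of the curve. *)
Lemma seed_ratio_bound (p : R * R) (e : R) : U p -> 0 < e ->
  exists2 d, 0 < d & forall z0 x, ball p d z0 -> ball (0 : R) d x -> t z0 = t p ->
    let z := z0 + x *: V p in
    [/\ U z, (psi @` U) (s z, t p)
      & f z / f (psi_inv (s z, t p)) - 1 <= x * - H p + `|x| * e].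
Proof.
move=> Up e0.
(* Two mean value theorems, along the seed curve and along V p, turn the left-hand
   side into - x * (k y1 * l z' / f w) with y1, z', w close to p. *)
pose k (y : R * R) := f y * H y / lam y.
pose l (y : R * R) := lam y * dot (V y) (V p).
(* The mean value points are unrelated to each other, hence joint continuity at (p, p, p) in three
   independent variables. The value there is [H p], since [f p] and [lam p] cancel and [V p] is a
   unit vector. *)
have [d1 /= d10 near1] : exists2 d, 0 < d & forall y1 y2 y3,
    ball p d y1 -> ball p d y2 -> ball p d y3 ->
    [/\ U y1, U y2, U y3 & `|H p - k y1 * l y2 / f y3| < e].
  have fp : f p != 0 by rewrite gt_eqF ?f_gt0.
  have lp : lam p != 0 by rewrite gt_eqF ?lam_gt0.
  have kc : k x @[x --> p] --> k p.
    by apply: cvgM; [apply: cvgM; [exact: f_cont|exact: H_cont]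
                    |apply: cvgV => //; exact: lam_cont].
  have lc : l x @[x --> p] --> l p.
    apply: cvgM; first exact: lam_cont.
    by apply: cvgD; apply: cvgM (cvg_cst _);
      apply: (cvg_comp V _ (V_cont Up)); [exact: cvg_fst|exact: cvg_snd].
  have Kc : k x.1.1 * l x.1.2 / f x.2 @[x --> (p, p, p)] --> H p.
    have -> : H p = k p * l p / f p.
      by rewrite /k /l V_unit// mulr1 divfK// mulrAC divff// mul1r.
    apply: cvgM; last apply: cvgV => //.
    - apply: cvgM.
        by apply: (cvg_comp (fst \o fst) k _ kc); apply: cvg_comp; exact: cvg_fst.
      by apply: (cvg_comp (snd \o fst) l _ lc); apply: cvg_comp;
        [exact: cvg_fst|exact: cvg_snd].
    - by apply: (cvg_comp snd f _ (f_cont Up)); exact: cvg_snd.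
  have nU : \forall y \near p, U y by apply: open_nbhs_nbhs; split => //; exact: U_open.
  move: Kc => /cvgrPdist_lt/(_ _ e0)/nbhs_ballP[d2 /= d20 K2].
  move: nU => /nbhs_ballP[d3 /= d30 U3].
  exists (Num.min d2 d3); first by rewrite lt_min d20.
  move=> y1 y2 y3 b1 b2 b3.
  have le2 y : ball p (Num.min d2 d3) y -> ball p d2 y.
    by apply: le_ball; rewrite ge_min lexx.
  have le3 y : ball p (Num.min d2 d3) y -> ball p d3 y.
    by apply: le_ball; rewrite ge_min lexx orbT.
  split; try by apply/U3/le3.
  by apply: (K2 (y1, y2, y3)); split; [split|]; exact: le2.
have [_ _ _ _ psiK] := diffeo.
have Epsi z : U z -> (psi @` U) (psi z) by move=> Uz; exists z.
have [d2 /= d20 near2] : exists2 d, 0 < d & forall q, ball (psi p) d q ->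
    (psi @` U) q /\ ball p d1 (psi_inv q).
  have nE : \forall q \near psi p, (psi @` U) q.
    by apply: open_nbhs_nbhs; split; [exact: psiU_open | exact: Epsi].
  have nB : \forall q \near psi p, ball p d1 (psi_inv q).
    apply: (psi_inv_cont (Epsi _ Up)); rewrite (psiK _ Up).
    exact: nbhsx_ballx.
  have /nbhs_ballP : nbhs (psi p) [set q | (psi @` U) q /\ ball p d1 (psi_inv q)].
    exact: filterI.
  by case=> d /= d0 h; exists d.
have [d3 /= d30 near3] : exists2 d, 0 < d & forall z, ball p d z ->
    ball p d1 z /\ ball (psi p) d2 (psi z).
  have nP : \forall z \near p, ball (psi p) d2 (psi z).
    by apply: (psi_cont Up); exact: nbhsx_ballx.
  have /nbhs_ballP : nbhs p [set z | ball p d1 z /\ ball (psi p) d2 (psi z)].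
    by apply: filterI => //; exact: nbhsx_ballx.
  by case=> d /= d0 h; exists d.
have [d4 /= d40 near4] : exists2 d, 0 < d & forall z0 x,
    ball p d z0 -> ball (0 : R) d x -> ball p d3 (z0 + x *: V p).
  have : y.1 + y.2 *: V p @[y --> (p, 0 : R)] --> p.
    rewrite -[X in _ --> X]addr0 -[X in _ + X](scale0r (V p)).
    by apply: cvgD; [exact: cvg_fst | apply: cvgZr_tmp; exact: cvg_snd].
  move=> /(_ _ (nbhsx_ballx p _ d30))/nbhs_ballP[d /= d0 h].
  by exists d => // z0 x bz bx; exact: (h (z0, x)).
exists d4 => // z0 x bz0 bx tz0; set z := z0 + _.
have bz : ball p d3 z by exact: near4.
have [b1z [bs bt]] := near3 _ bz.
have [Uz _ _ _] := near1 _ _ _ b1z b1z b1z.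
(* Balls of the max norm are squares: the whole vertical segment over [s z] with t within [d2] of
   [t p] lies in the image, and it contains both psi z and psi w. *)
have col y : ball (t p) d2 y -> (psi @` U) (s z, y) /\ ball p d1 (psi_inv (s z, y)).
  by move=> yb; apply: near2.
have [Ew bw] := col _ (ballxx (t p) d20).
split => //; have [_ _ Uw _] := near1 _ _ _ b1z b1z bw.
have fd y : ball (t p) d2 y -> is_derive y 1 (fun y => f (psi_inv (s z, y)))
    (- k (psi_inv (s z, y))).
  by move=> /col[Ey _]; have := is_derive_f_col Ey; rewrite /= mulNr.
have [y yb Ey] := MVT_ball fd (ballxx (t p) d20) bt.
have [x' xb Ex] : exists2 x', ball (0 : R) d4 x' &
    t z - t p = l (z0 + x' *: V p) * x.
  have td x' : ball (0 : R) d4 x' ->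
      is_derive x' 1 (fun x => t (z0 + x *: V p)) (l (z0 + x' *: V p)).
    move=> bx'; have [b1 _] := near3 _ (near4 _ _ bz0 bx').
    have [U1 _ _ _] := near1 _ _ _ b1 b1 b1.
    have gd : is_derive x' (1 : R) (fun x : R => z0 + x *: V p) (V p).
      exact: is_derive_line.
    have := @is_derive_along_curve _ t (fun x => z0 + x *: V p) x' (V p) (t_diff U1) gd.
    by rewrite t_grad// dotZl.
  have [x' x'b] := MVT_ball td (ballxx 0 d40) bx.
  by rewrite scale0r addr0 tz0 subr0 => E; exists x'.
have [b1' _] := near3 _ (near4 _ _ bz0 xb).
have [_ _ _ near5] := near1 _ _ _ (col _ yb).2 b1' bw.
move: Ey near5; rewrite /= (psiK _ Uz) Ex.
set w := psi_inv (s z, t p); set y1 := psi_inv _; set z' := z0 + _ => Ey near5.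
have fw : f w != 0 by rewrite gt_eqF ?f_gt0.
have -> : f z / f w - 1 = x * - H p + x * (H p - k y1 * l z' / f w).
  rewrite -[1](divff fw) -mulrBl Ey mulNr.
  by ring.
rewrite lerD2l (le_trans (ler_norm _))// normrM ler_wpM2l// ltW//.
Qed.

Lemma near_curve_translate (p : R * R) (gamma : R -> R * R) (r0 : R) (B : set (R * R)) :
  {for r0, continuous gamma} -> gamma r0 = p -> nbhs p B ->
  exists2 d, 0 < d & forall r x, ball r0 d r -> ball (0 : R) d x ->
    B (gamma r + x *: V p).
Proof.
move=> gc gp nB.
have : gamma y.1 + y.2 *: V p @[y --> (r0, 0 : R)] --> p.
  rewrite -[X in _ --> X]addr0 -[X in _ + X](scale0r (V p)) -[X in X + _]gp.
  apply: cvgD; last by apply: cvgZr_tmp; exact: cvg_snd.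
  by apply: (cvg_comp fst gamma _ gc); exact: cvg_fst.
move=> /(_ _ nB)/nbhs_ballP[d /= d0 h].
by exists d => // r x br bx; exact: (h (r, x)).
Qed.

(** [V] is only continuous, so a mixed difference of Phi is used: [Phi x r2 - Phi x r1] is bounded
    through the derivative of Phi in r, while its derivative in x at 0 is [m r2 - m r1]. *)
Lemma is_derive_perp_component (p : R * R) (a b : R) (gamma : R -> R * R) (A : R -> R) :
  U p -> integral_curve (perp \o V) U a b gamma ->
  (forall r, a < r < b -> t (gamma r) = t p /\ A (s (gamma r)) = r) ->
  (\forall x \near s p, is_derive (x : R) (1 : R) A (f (psi_inv (x, t p)))^-1) ->
  a < A (s p) < b -> gamma (A (s p)) = p ->
  is_derive (A (s p)) 1 (fun r => dot (perp (V (gamma r))) (V p)) (- H p).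
Proof.
move=> Up gU gt nA; set r0 := A (s p) => r0ab gr0.
have [_ _ _ _ psiK] := diffeo.
set m := fun r => dot (perp (V (gamma r))) (V p).
apply: is_derive_of_estimate => e e0.
have [d d0 bound] := seed_ratio_bound Up e0.
have gc : {for r0, continuous gamma}.
  have [_ [/derivable1_diffP gd _]] := gU _ r0ab.
  exact: differentiable_continuous.
(* The condition involves only [s z], so it is pulled back from a neighbourhood of [s p] by
   continuity of s. *)
have nB : nbhs p [set z : R * R | is_derive (s z) (1 : R) A (f (psi_inv (s z, t p)))^-1].
  exact: (differentiable_continuous (s_diff Up) nA).
have [d1 d10 Ad] := near_curve_translate gc gr0 nB.
have [d2 d20 bd2] : exists2 d2, 0 < d2 &
    forall r, ball r0 d2 r -> a < r < b /\ ball p d (gamma r).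
  have h1 : \forall r \near r0, a < r < b by exact: near_in_itvoo.
  have h2 : \forall r \near r0, ball p d (gamma r).
    by apply: gc; rewrite gr0; exact: nbhsx_ballx.
  have /nbhs_ballP[d2 /= d20 h] : nbhs r0 [set r | a < r < b /\ ball p d (gamma r)].
    exact: filterI.
  by exists d2.
pose del := Num.min d1 (Num.min d2 d).
have del0 : 0 < del by rewrite !lt_min d10 d20.
have bdel (c x : R) : ball c del x -> [/\ ball c d1 x, ball c d2 x & ball c d x].
  move=> h; split; apply: le_ball h; rewrite /del !ge_min lexx ?orbT//.
(* A inverts [s \o gamma], so A (s z) - r is Phi_x (r) of the header. *)
pose Phi x r := A (s (gamma r + x *: V p)) - r.
have Phi_slope x r : ball (0 : R) del x -> ball r0 del r ->
    exists2 c, is_derive r 1 (Phi x) c & c <= x * - H p + `|x| * e.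
  move=> /bdel[x1 x2 x3] /bdel[r1 r2 r3].
  have [rab br] := bd2 _ r2; have [tr _] := gt _ rab.
  have [/=] := bound _ _ br x3 tr.
  have := Ad _ _ r1 x1 => /=.
  have [Ur gd] := gU _ rab.
  set z := gamma r + _; set w := psi_inv _ => Az Uz Ew le.
  have [Uw _] := psi_invK Ew.
  exists ((f w)^-1 * dot (grad s z) (perp (V (gamma r))) - 1).
    apply: is_deriveB.
    apply: (@is_derive_comp1 _ A (fun r => s (gamma r + x *: V p))).
    apply: (is_derive_along_curve (s_diff Uz)).
    exact: is_derive_translate.
  (* The calibration inequality: the cosine of the angle between the two unit vectors is replaced by
     1. *)
  apply: le_trans le; rewrite lerD2r s_grad// dotZl mulrC -mulrA ler_wpM2l//.
    exact/ltW/f_gt0.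
  by rewrite ler_piMl ?invr_ge0 ?(ltW (f_gt0 Uw))// dot_unit_le1// perp_unit.
have Phi0 r : ball r0 del r -> Phi 0 r = 0.
  move=> /bdel[_ /bd2[rab _] _]; have [_ Ar] := gt _ rab.
  by rewrite /Phi scale0r addr0 Ar subrr.
(* At x = 0 both z and w are [gamma r], so the factor 1 / f from [A] cancels the f in the gradient
   of s. *)
have Phi_x r : ball r0 del r -> is_derive (0 : R) 1 (fun x => Phi x r) (m r).
  move=> /bdel[r1 /bd2[rab br] _].
  have [Ur _] := gU _ rab; have [tr _] := gt _ rab.
  have zE : gamma r + 0 *: V p = gamma r by rewrite scale0r addr0.
  have fr : f (gamma r) != 0 by rewrite gt_eqF ?f_gt0.
  have -> : m r = (f (gamma r))^-1 * dot (grad s (gamma r + 0 *: V p)) (V p) - 0.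
    by rewrite subr0 zE s_grad// dotZl mulKf.
  apply: is_deriveB.
  apply: (@is_derive_comp1 _ A (fun x => s (gamma r + x *: V p))).
    have := Ad _ _ r1 (ballxx 0 d10); rewrite /= zE -tr.
    by have := psiK _ Ur => /= ->.
  by apply: is_derive_along_curve; [rewrite zE; exact: s_diff | exact: is_derive_line].
have slope r1 r2 : r1 <= r2 -> ball r0 del r1 -> ball r0 del r2 ->
    `|m r2 - m r1 - - H p * (r2 - r1)| <= e * (r2 - r1).
  move=> r12 b1 b2.
  apply: (@one_sided_slope _ (fun x => Phi x r2 - Phi x r1)).
  - by apply: is_deriveB; exact: Phi_x.
  - by rewrite !Phi0// subrr.
  - near=> x.
    have bx : ball (0 : R) del x by near: x; exact: nbhsx_ballx.
    (* For fixed x, the mean value theorem in r carries the bound on the slope over to the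
       difference. *)
    have Pd r : ball r0 del r -> is_derive r 1 (Phi x) ('D_1 (Phi x) r).
      by move=> /(Phi_slope _ _ bx)[c [? _] _]; exact: derivableP.
    have [c cb ->] := MVT_ball Pd b1 b2.
    have [c' [_ ->] le] := Phi_slope _ _ bx cb.
    by rewrite !mulrA -mulrDl ler_wpM2r// subr_ge0.
near=> r.
have br : ball r0 del r by near: r; exact: nbhsx_ballx.
have b0 := ballxx r0 del0.
have [rr0|r0r] := leP r r0.
  rewrite distrC [`|r - r0|]distrC [`|r0 - r|]ger0_norm ?subr_ge0//.
  have := slope _ _ rr0 br b0; congr (`| _ | <= _); ring.
rewrite [`|r - r0|]gtr0_norm ?subr_gt0//; exact: slope (ltW r0r) b0 br.
Unshelve. all: by end_near. Qed.

(** The angle turns at rate - H per unit of arc length, and arc length grows at rate 1 / f in s. *)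
Lemma is_derive_theta_row (W : set (R * R)) (theta : R * R -> R) (q : R * R) :
  open W -> cont_on W theta ->
  (forall p, W p -> V p = (cos (theta p), sin (theta p))) ->
  (psi @` (U `&` W)) q ->
  is_derive q.1 1 (fun x => theta (psi_inv (x, q.2)))
    (- (H (psi_inv q) / f (psi_inv q))).
Proof.
move=> oW thc Vth [p [Up Wp] pq].
have [_ _ _ _ psiK] := diffeo.
have Eq : (psi @` U) q by exists p.
have [a [b [gamma [A [gU gt nA]]]]] := row_curve Eq.
move: nA gt; rewrite -pq (psiK _ Up) /= => nA gt.
have [r0ab gr0 Ad] := nbhs_singleton nA.
move: gr0 Ad; rewrite (psiK _ Up) => gr0 Ad.
apply: (@near_eq_is_derive _ _ _ ((theta \o gamma) \o A)).
  by apply: filterS nA => x [_ /= -> _].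
rewrite -mulNr; apply: is_derive_comp1.
have gc : {for A (s p), continuous gamma}.
  have [_ [/derivable1_diffP gd _]] := gU _ r0ab.
  exact: differentiable_continuous.
apply: is_derive_angle.
  by apply: (cvg_comp gamma theta gc); rewrite /= gr0; exact: thc.
have nA' : \forall x \near s p, is_derive (x : R) (1 : R) A (f (psi_inv (x, t p)))^-1.
  by apply: filterS nA => x [].
(* In terms of the angle, [dot (perp (V (gamma r))) (V p)] is sin (theta (gamma r) - theta p). *)
apply: near_eq_is_derive (is_derive_perp_component Up gU gt nA' r0ab gr0).
have nW : \forall r \near A (s p), W (gamma r).
  by apply: gc; rewrite gr0; apply: open_nbhs_nbhs.
apply: filterS nW => r Wr /=.
by rewrite gr0 Vth// Vth// sinB /dot/= mulNr.
Qed.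

Lemma theta_s_row (W : set (R * R)) (theta : R * R -> R) :
  open W -> cont_on W theta ->
  (forall p, W p -> V p = (cos (theta p), sin (theta p))) ->
  let E := psi @` (U `&` W) in
  let theta_s q := 'D_((1, 0) : R * R) (theta \o psi_inv) q in
  [/\ forall q, E q -> derivable (theta \o psi_inv) q ((1, 0) : R * R),
      cont_on E theta_s
    & forall q, E q -> theta_s q = - (H (psi_inv q) / f (psi_inv q))].
Proof.
move=> oW thc Vth E theta_s.
have [_ _ _ _ psiK] := diffeo.
have thd q : E q -> is_derive q ((1, 0) : R * R) (theta \o psi_inv)
    (- (H (psi_inv q) / f (psi_inv q))).
  by move=> Eq; apply: is_derive_row; exact: (is_derive_theta_row oW thc Vth Eq).
have theta_sE q : E q -> theta_s q = - (H (psi_inv q) / f (psi_inv q)).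
  by move=> /thd[].
split => // [q /thd[]//|q Eq].
have [p [Up Wp] pq] := Eq.
have psiUq : (psi @` U) q by exists p.
have [Uq _] := psi_invK psiUq.
(* The formula for [theta_s] is known on [E] only; as [E] is a neighbourhood of q, continuity passes
   from the right-hand side to [theta_s]. *)
have nE : \forall q' \near q, E q'.
  have n1 : \forall q' \near q, (psi @` U) q'.
    by apply: open_nbhs_nbhs; split; first exact: psiU_open.
  have n2 : \forall q' \near q, W (psi_inv q').
    by apply: (psi_inv_cont psiUq); rewrite -pq psiK//; exact: open_nbhs_nbhs.
  near=> q'.
  have [U' q'E] : U (psi_inv q') /\ psi (psi_inv q') = q'.
    by apply: psi_invK; near: q'.
  by exists (psi_inv q') => //; split => //; near: q'.
have fq : f (psi_inv q) != 0 by rewrite gt_eqF ?f_gt0.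
have c : - (H (psi_inv q') / f (psi_inv q')) @[q' --> q] -->
    - (H (psi_inv q) / f (psi_inv q)).
  apply: cvgN; apply: cvgM; last apply: cvgV => //.
    by apply: (cvg_comp psi_inv H (psi_inv_cont psiUq)); exact: H_cont.
  by apply: (cvg_comp psi_inv f (psi_inv_cont psiUq)); exact: f_cont.
have := c; rewrite -(theta_sE _ Eq); apply: cvg_trans.
apply: near_eq_cvg; apply: filterS nE => q' /theta_sE; exact: esym.
Unshelve. all: by end_near. Qed.

End TurningRate.

(** * The Euclidean norm and the application to N *)

Lemma enorm_gt0 (R : realType) (v : R * R) : v <> 0 -> 0 < enorm v.
Proof.
case: v => x y v0; rewrite sqrtr_gt0 /dot/= -!expr2 lt_def addr_ge0 ?sqr_ge0// andbT.
rewrite paddr_eq0 ?sqr_ge0// !sqrf_eq0; apply/negP => /andP[/eqP x0 /eqP y0].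
by apply: v0; rewrite x0 y0.
Qed.

Lemma dot_normalized (R : realType) (v : R * R) : v <> 0 ->
  dot ((enorm v)^-1 *: v) ((enorm v)^-1 *: v) = 1.
Proof.
move=> v0; have e0 := lt0r_neq0 (enorm_gt0 v0).
have e2 : dot v v = enorm v ^+ 2.
  by rewrite /enorm sqr_sqrtr// /dot -!expr2 addr_ge0 ?sqr_ge0.
have -> : dot ((enorm v)^-1 *: v) ((enorm v)^-1 *: v) = (enorm v)^-1 ^+ 2 * dot v v.
  by rewrite /dot /= /GRing.scale/=; ring.
by rewrite e2 -exprMn mulVf// expr1n.
Qed.

Lemma enorm_cont (R : realType) : continuous (@enorm R).
Proof.
move=> v; apply: continuous_comp; last exact: sqrt_continuous.
by apply: cvgD; apply: cvgM; (exact: cvg_fst || exact: cvg_snd).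
Qed.

Theorem corollaryC1 (R : realType) (Omega : set (R * R))
    (F : R * R -> R * R) (H u : R * R -> R)
    (hOmega : domain Omega)
    (hF : Ck_map_on 1 Omega F)
    (hH : cont_on Omega H)
    (hu : Ck_on 1 Omega u)
    (hns : forall p, Omega p -> grad u p + F p <> 0)
    (hweak : weak_solution u F H Omega)
    (p0 : R * R) (hp0 : Omega p0)
    (U : set (R * R)) (hU : open U) (hUp0 : U p0) (hUO : U `<=` Omega)
    (s t f g : R * R -> R) (psi_inv : R * R -> R * R)
    (hst : characteristic_coordinates u F H U s t f g psi_inv)
    (W : set (R * R)) (hW : open W) (hWp0 : W p0) (hWO : W `<=` Omega)
    (theta : R * R -> R) (htheta : cont_on W theta)
    (hNtheta : forall p, W p -> Nfun u F p = (cos (theta p), sin (theta p))) :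
  let E := (fun p => (s p, t p)) @` (U `&` W) in
  let theta_st := theta \o psi_inv in
  let theta_s := fun q => 'D_((1, 0) : R * R) theta_st q in
  [/\ forall q, E q -> derivable theta_st q ((1, 0) : R * R),
      cont_on E theta_s
    & forall q, E q -> theta_s q = - (H (psi_inv q) / f (psi_inv q))].
Proof.
move=> E theta_st theta_s.
have [sC1 tC1 fC gC f0 g0 tl sl gs gt [Nf [Nfd NfC NfE]] _ dif _] := hst.
have [sd _ _] := sC1; have [td _ _] := tC1.
have gradu p : U p -> grad u p + F p <> 0 by move=> /hUO/hns.
have Dc p : U p -> {for p, continuous (fun q => grad u q + F q)}.
  move=> /hUO Op; have [_ ux uy] := hu.
  have [[F1 _ _] [F2 _ _]] := hF.
  apply: cvgD; first exact: cvg_pair (ux _ Op) (uy _ Op).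
  have -> : F = fun q => ((F q).1, (F q).2) by apply/funext => q; case: (F q).
  exact: differentiable_continuous (differentiable_pair (F1 _ Op) (F2 _ Op)).
have Dcont : cont_on U (Dfun u F).
  move=> p Up.
  apply: (cvg_comp (fun q => grad u q + F q) enorm (Dc _ Up)); exact: enorm_cont.
have D0 p : U p -> 0 < Dfun u F p by move=> /gradu; exact: enorm_gt0.
have Nc p : U p -> {for p, continuous (Nfun u F)}.
  move=> Up; apply: cvgZ; last exact: Dc.
  by apply: cvgV; [rewrite gt_eqF ?D0 | exact: Dcont].
(* The gradient of t has length g D, which is therefore the speed [lam] of t along seed curves. *)
apply: (@theta_s_row R U s t f (fun p => g p * Dfun u F p) H (Nfun u F) psi_inv) => //.
- by move=> p /gradu; exact: dot_normalized.
- by move=> p Up; rewrite mulr_gt0 ?g0 ?D0.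
- by move=> p Up; apply: cvgM; [exact: gC | exact: Dcont].
- by move=> p /hUO; exact: hH.
(* On a seed curve in [U] the equation Nf + f H = 0 identifies the derivative of f as - f H. *)
- move=> a b gamma ga r rab; apply: is_derive_eq (Nfd _ _ _ ga _ rab) _.
  by have [/NfE/eqP + _] := ga _ rab; rewrite addr_eq0 => /eqP.
Qed.
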